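(* Let $a,b$ be commuting indeterminates. Let $R$ be a subset of the positive integers and let $\rho\colon R\to E$ be a map, where $E$ is the set of even positive integers. Let $\mathrm{Par}(R,\rho)$ be the set of all integer partitions $\lambda=(\lambda_1\ge\lambda_2\ge\cdots)$ (including the empty partition) such that every $r\in R$ occurs as a part of $\lambda$ with multiplicity less than $\rho(r)$. For a partition $\lambda$ define $$\omega_1(\lambda)=a^{\sum_{i\ge1}\lceil\lambda_{2i-1}/2\rceil}\,a^{\sum_{i\ge1}\lfloor\lambda_{2i-1}/2\rfloor}\,b^{\sum_{i\ge1}\lceil\lambda_{2i}/2\rceil}\,b^{\sum_{i\ge1}\lfloor\lambda_{2i}/2\rfloor}$$ (so $\omega_1(\lambda)=a^{\lambda_1+\lambda_3+\cdots}b^{\lambda_2+\lambda_4+\cdots}$), and let $\Phi_{R,\rho}(a,a,b,b)=\sum_{\lambda\in\mathrm{Par}(R,\rho)}\omega_1(\lambda)$. Then, as formal power series, $$\Phi_{R,\rho}(a,a,b,b)=\prod_{j=1}^{\infty}\frac{1+a^{\lceil\frac{j}{2}\rceil+\lfloor\frac{j}{2}\rfloor}b^{\lceil\frac{j-1}{2}\rceil+\lfloor\frac{j-1}{2}\rfloor}}{\left(1-a^{\lceil\frac{j}{2}\rceil+\lfloor\frac{j}{2}\rfloor}b^{\lceil\frac{j}{2}\rceil+\lfloor\frac{j}{2}\rfloor}\right)\left(1-a^{2j}b^{2j-2}\right)}\times\prod_{r\in R}\left(1-a^{(\lceil\frac{r}{2}\rceil+\lfloor\frac{r}{2}\rfl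oor)\frac{\rho(r)}{2}}b^{(\lceil\frac{r}{2}\rceil+\lfloor\frac{r}{2}\rfloor)\frac{\rho(r)}{2}}\right).$$
   Context: A partition $\lambda$ is written with parts in nonincreasing order $\lambda_1\ge\lambda_2\ge\cdots\ge\lambda_r>0$; parts $\lambda_i$ with $i>r$ are taken to be $0$. *)

(* Defs.v *)
From HB Require Import structures.
From mathcomp Require Import all_boot all_order all_algebra.
From mathcomp Require Import finmap.
From mathcomp Require Import boolp classical_sets.

Set Implicit Arguments.
Unset Strict Implicit.
Unset Printing Implicit Defensive.

Import GRing.Theory.
Local Open Scope classical_set_scope.
Local Open Scope ring_scope.

(* [Fps2 f] is the formal power series \sum_(m, n) f m n a^m b^n of K[[a, b]].
   A record rather than an alias of [nat -> nat -> K], so that the pointwise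
   product of functions cannot be inferred for it. *)
Record fps2 (K : Type) := Fps2 { fps_coef : nat -> nat -> K }.

HB.instance Definition _ (K : Type) := gen_eqMixin (fps2 K).
HB.instance Definition _ (K : Type) := gen_choiceMixin (fps2 K).

Lemma fps2P (K : Type) (f g : fps2 K) :
  (forall m n, fps_coef f m n = fps_coef g m n) -> f = g.
Proof.
case: f g => [f] [g] /= fg; congr Fps2.
by apply/funext => m; apply/funext => n.
Qed.

Section Ring.
Context {K : comNzRingType}.
Implicit Types f g h : fps2 K.

Definition fps_zero : fps2 K := Fps2 (fun _ _ => 0).
Definition fps_opp f : fps2 K := Fps2 (fun m n => - fps_coef f m n).
Definition fps_add f g : fps2 K :=
  Fps2 (fun m n => fps_coef f m n + fps_coef g m n).
Definition fps_one : fps2 K :=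
  Fps2 (fun m n => ((m == 0%N) && (n == 0%N))%:R).
Definition fps_mul f g : fps2 K :=
  Fps2 (fun m n => \sum_(i < m.+1) \sum_(j < n.+1)
                     fps_coef f i j * fps_coef g (m - i) (n - j)).

Fact fps_addA : associative fps_add.
Proof. by move=> f g h; apply: fps2P => m n /=; rewrite addrA. Qed.
Fact fps_addC : commutative fps_add.
Proof. by move=> f g; apply: fps2P => m n /=; rewrite addrC. Qed.
Fact fps_add0 : left_id fps_zero fps_add.
Proof. by move=> f; apply: fps2P => m n /=; rewrite add0r. Qed.
Fact fps_addN : left_inverse fps_zero fps_opp fps_add.
Proof. by move=> f; apply: fps2P => m n /=; rewrite addNr. Qed.

HB.instance Definition _ :=
  GRing.isZmodule.Build (fps2 K) fps_addA fps_addC fps_add0 fps_addN.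

(* The ring axioms are transferred from {poly {poly K}} by truncation. *)
Definition fps_trunc (N : nat) f : {poly {poly K}} :=
  \poly_(i < N) \poly_(j < N) fps_coef f i j.

Lemma coef_fps_trunc N f m n : (m < N)%N -> (n < N)%N ->
  (fps_trunc N f)`_m`_n = fps_coef f m n.
Proof. by move=> mN nN; rewrite coef_poly mN coef_poly nN. Qed.

Lemma coef_poly2M (p q : {poly {poly K}}) m n :
  (p * q)`_m`_n =
  \sum_(i < m.+1) \sum_(j < n.+1) p`_i`_j * q`_(m - i)`_(n - j).
Proof.
by rewrite coefM coef_sum; apply: eq_bigr => i _; rewrite coefM.
Qed.

Lemma coef_poly2M_eq (p q p' q' : {poly {poly K}}) m n :
  (forall i j, (i <= m)%N -> (j <= n)%N -> p`_i`_j = p'`_i`_j) ->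
  (forall i j, (i <= m)%N -> (j <= n)%N -> q`_i`_j = q'`_i`_j) ->
  (p * q)`_m`_n = (p' * q')`_m`_n.
Proof.
move=> pp' qq'; rewrite !coef_poly2M.
apply: eq_bigr => i _; apply: eq_bigr => j _.
by rewrite pp' ?qq' ?leq_subr // -ltnS.
Qed.

Lemma coef_fps_truncM N f g m n : (m < N)%N -> (n < N)%N ->
  (fps_trunc N f * fps_trunc N g)`_m`_n = fps_coef (fps_mul f g) m n.
Proof.
move=> mN nN; rewrite coef_poly2M /=.
apply: eq_bigr => i _; apply: eq_bigr => j _.
by rewrite !coef_fps_trunc //;
   first [exact: leq_ltn_trans (leq_subr _ _) _
         | exact: leq_ltn_trans (leq_ord _) _].
Qed.

Fact fps_mulA : associative fps_mul.
Proof.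
move=> f g h; apply: fps2P => m n.
pose N := (maxn m n).+1.
have mN : (m < N)%N by rewrite ltnS leq_maxl.
have nN : (n < N)%N by rewrite ltnS leq_maxr.
rewrite -!(@coef_fps_truncM N) //.
transitivity ((fps_trunc N f * (fps_trunc N g * fps_trunc N h))`_m`_n).
  apply: coef_poly2M_eq => // i j im jn.
  have iN := leq_ltn_trans im mN; have jN := leq_ltn_trans jn nN.
  by rewrite coef_fps_trunc // coef_fps_truncM.
rewrite mulrA; apply: coef_poly2M_eq => // i j im jn.
have iN := leq_ltn_trans im mN; have jN := leq_ltn_trans jn nN.
by rewrite [RHS]coef_fps_trunc // coef_fps_truncM.
Qed.

Fact fps_mulC : commutative fps_mul.
Proof.
move=> f g; apply: fps2P => m n.
pose N := (maxn m n).+1.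
have mN : (m < N)%N by rewrite ltnS leq_maxl.
have nN : (n < N)%N by rewrite ltnS leq_maxr.
by rewrite -!(@coef_fps_truncM N) // mulrC.
Qed.

Fact fps_mul1 : left_id fps_one fps_mul.
Proof.
move=> f; apply: fps2P => m n /=.
rewrite big_ord_recl big_ord_recl /= mul1r !subn0.
rewrite [X in _ + X + _]big1 ?addr0; last by move=> j _; rewrite mul0r.
by rewrite big1 ?addr0 // => i _; rewrite big1 // => j _; rewrite mul0r.
Qed.

Fact fps_mulDl : left_distributive fps_mul fps_add.
Proof.
move=> f g h; apply: fps2P => m n /=.
rewrite -big_split; apply: eq_bigr => i _ /=.
by rewrite -big_split; apply: eq_bigr => j _ /=; rewrite mulrDl.
Qed.

Fact fps_one_neq0 : fps_one != 0.
Proof.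
apply/eqP => /(congr1 (fun f => fps_coef f 0 0)) /= /eqP.
by rewrite oner_eq0.
Qed.

HB.instance Definition _ := GRing.Zmodule_isComNzRing.Build (fps2 K)
  fps_mulA fps_mulC fps_mul1 fps_mulDl fps_one_neq0.

Definition fps_unit f : bool := `[< exists g, g * f = 1 >].

(* As everywhere in MathComp, the inverse of a non-unit is itself. *)
Definition fps_inv f : fps2 K := xget f [set g | g * f = 1].

Fact fps_mulVr : {in fps_unit, left_inverse 1 fps_inv *%R}.
Proof. by move=> f /asboolP fu; exact: (xgetPex f fu). Qed.

Fact fps_unitPl f g : g * f = 1 -> fps_unit f.
Proof. by move=> gf; apply/asboolP; exists g. Qed.

Fact fps_invr_out : {in [predC fps_unit], fps_inv =1 id}.
Proof.
move=> f /asboolPn nu; rewrite /fps_inv; case: xgetP => // g _ gf.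
by case: nu; exists g.
Qed.

HB.instance Definition _ := GRing.ComNzRing_hasMulInverse.Build (fps2 K)
  fps_mulVr fps_unitPl fps_invr_out.

Lemma fps_coef0 m n : fps_coef (0 : fps2 K) m n = 0.
Proof. by []. Qed.
Lemma fps_coef1 m n :
  fps_coef (1 : fps2 K) m n = ((m == 0%N) && (n == 0%N))%:R.
Proof. by []. Qed.
Lemma fps_coefN f m n : fps_coef (- f) m n = - fps_coef f m n.
Proof. by []. Qed.
Lemma fps_coefD f g m n :
  fps_coef (f + g) m n = fps_coef f m n + fps_coef g m n.
Proof. by []. Qed.
Lemma fps_coefM f g m n : fps_coef (f * g) m n =
  \sum_(i < m.+1) \sum_(j < n.+1)
    fps_coef f i j * fps_coef g (m - i) (n - j).
Proof. by []. Qed.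

Lemma fps_coefX_eq0 f k m n :
  fps_coef f 0 0 = 0 -> (m + n < k)%N -> fps_coef (f ^+ k) m n = 0.
Proof.
move=> f0; elim: k m n => // k IHk m n; rewrite ltnS => mnk.
rewrite exprS fps_coefM big1 // => i _; rewrite big1 // => j _.
have im := leq_ord i; have jn := leq_ord j.
have [/eqP ij0|ij_gt0] := posnP (i + j).
  by move: ij0; rewrite addn_eq0 => /andP[/eqP-> /eqP->]; rewrite f0 mul0r.
rewrite IHk ?mulr0 //; apply: leq_trans mnk.
have -> : (m - i + (n - j) = m + n - (i + j))%N.
  by rewrite addnBA // addnBAC // subnDA.
by rewrite ltn_subrL ij_gt0 (leq_trans ij_gt0) // leq_add.
Qed.

(* Hence the denominators 1 - a^m b^n, (m, n) != (0, 0), are invertible. *)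
Lemma fps_unit1B f : fps_coef f 0 0 = 0 -> 1 - f \is a GRing.unit.
Proof.
move=> f0; pose S N : fps2 K := \sum_(k < N) f ^+ k.
have SS N m n : (m + n < N)%N ->
    fps_coef (S N) m n = fps_coef (S (m + n).+1) m n.
  elim: N => // N IHN; rewrite ltnS leq_eqVlt => /predU1P[<- //|mnN].
  by rewrite /S big_ord_recr fps_coefD /= fps_coefX_eq0 // addr0 -IHN.
apply/unitrPr; exists (Fps2 (fun m n => fps_coef (S (m + n).+1) m n)).
apply: fps2P => m n; pose N := (m + n).+1.
transitivity (fps_coef ((1 - f) * S N) m n).
  rewrite !fps_coefM; apply: eq_bigr => i _; apply: eq_bigr => j _ /=.
  by rewrite (SS N) // ltnS leq_add // leq_subr.
by rewrite /S -opprB mulNr -subrX1 opprB fps_coefD fps_coefN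
           fps_coefX_eq0 // subr0.
Qed.

End Ring.

Definition fps_a (K : comNzRingType) : fps2 K :=
  Fps2 (fun m n => ((m == 1%N) && (n == 0%N))%:R).
Definition fps_b (K : comNzRingType) : fps2 K :=
  Fps2 (fun m n => ((m == 0%N) && (n == 1%N))%:R).

Section InfiniteSumsProducts.
Context {K : comNzRingType} {I : choiceType}.
Implicit Types (A : set I) (F : I -> fps2 K) (u : {fset I} -> fps2 K).
Implicit Types (f g : fps2 K).

(* Convergence of the net [u] over the finite subsets of A, for the product
   topology of the discrete topologies on the coefficients: each coefficient
   is eventually constant. *)
Definition fps_cvg A u f : Prop :=
  forall m n, exists2 S0 : {fset I}, [set` S0] `<=` A &
    forall S : {fset I}, [set` S] `<=` A -> (S0 `<=` S)%fset ->
      fps_coef (u S) m n = fps_coef f m n.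

Lemma fps_cvg_unique A u f g : fps_cvg A u f -> fps_cvg A u g -> f = g.
Proof.
move=> uf ug; apply: fps2P => m n.
have [S SA Sf] := uf m n; have [T TA Tg] := ug m n.
have STA : [set` (S `|` T)%fset] `<=` A.
  by move=> i /=; rewrite in_fsetU => /orP[/SA|/TA].
by rewrite -(Sf (S `|` T)%fset) ?fsubsetUl // Tg ?fsubsetUr.
Qed.

Definition fps_has_sum A F f : Prop :=
  fps_cvg A (fun S => \sum_(i <- S) F i) f.
Definition fps_has_prod A F f : Prop :=
  fps_cvg A (fun S => \prod_(i <- S) F i) f.

Definition fps_summable A F : Prop := exists f, fps_has_sum A F f.
Definition fps_multipliable A F : Prop := exists f, fps_has_prod A F f.

(* The junk values 0 and 1 are only taken for divergent families. *)
Definition fps_sum A F : fps2 K := xget 0 [set f | fps_has_sum A F f].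
Definition fps_prod A F : fps2 K := xget 1 [set f | fps_has_prod A F f].

Lemma fps_sumE A F f : fps_has_sum A F f -> fps_sum A F = f.
Proof. by move=> Ff; apply: xget_unique => // g /fps_cvg_unique; exact. Qed.
Lemma fps_prodE A F f : fps_has_prod A F f -> fps_prod A F = f.
Proof. by move=> Ff; apply: xget_unique => // g /fps_cvg_unique; exact. Qed.

End InfiniteSumsProducts.

(* A partition is the nonincreasing sequence of its (positive) parts. *)
Definition is_partition (l : seq nat) : bool :=
  sorted geq l && all (leq 1) l.

(* [part l i] is \lambda_i for i >= 1, and is 0 beyond the last part. *)
Definition part (l : seq nat) (i : nat) : nat := nth 0%N l i.-1.

Definition Par (R : set nat) (rho : nat -> nat) : set (seq nat) :=
  [set l | is_partition l /\ forall r, R r -> (count_mem r l < rho r)%N].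

(* The terms with i > size l are 0 in each of the four sums. *)
Definition omega (K : comNzRingType) (x y z w : fps2 K) (l : seq nat) :
    fps2 K :=
  x ^+ (\sum_(1 <= i < (size l).+1) uphalf (part l (2 * i - 1))) *
  y ^+ (\sum_(1 <= i < (size l).+1) (part l (2 * i - 1))./2) *
  z ^+ (\sum_(1 <= i < (size l).+1) uphalf (part l (2 * i))) *
  w ^+ (\sum_(1 <= i < (size l).+1) (part l (2 * i))./2).

Definition Phi (K : comNzRingType) (R : set nat) (rho : nat -> nat)
    (x y z w : fps2 K) : fps2 K :=
  fps_sum (Par R rho) (omega x y z w).

(* Main.v *)
Require Import Defs.
From HB Require Import structures.
From mathcomp Require Import all_boot all_order all_algebra.
From mathcomp Require Import finmap.
From mathcomp Require Import boolp classical_sets.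
From mathcomp Require Import zify.

Set Implicit Arguments.
Unset Strict Implicit.
Unset Printing Implicit Defensive.

Import GRing.Theory.
Local Open Scope classical_set_scope.
Local Open Scope ring_scope.

(** Put [x_h := a^(ceil(h/2)) b^(floor(h/2))], the weight of a column of height
    [h].  Adding a column of height [h] multiplies [omega] by [x_h], so the
    partitions whose columns have heights in a finite set are counted by the
    product of the [1/(1 - x_h)] over that set; the [j]-th factor of the infinite
    product is [1/((1 - x_(2j-1)) (1 - x_(2j)))], since
    [(1 + x)/(1 - x^2) = 1/(1 - x)].  Inserting an even number [2c] of parts [r]
    leaves the parity of the other positions unchanged and multiplies [omega] by
    [(ab)^(rc)], so each restriction on the multiplicity of [r] amounts to a
    factor [1 - (ab)^(r rho(r)/2)].  Both infinite products are then the limits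
    of these finite identities, because a given coefficient only sees partitions
    of bounded size. *)

(** * Monomials *)

Section Monomial.
Context {K : comNzRingType}.
Implicit Types g : fps2 K.

Definition fps_mon (p q : nat) : fps2 K :=
  Fps2 (fun m n => ((m == p) && (n == q))%:R).

Lemma fps_coef_monM p q g m n :
  fps_coef (fps_mon p q * g) m n =
  if (p <= m)%N && (q <= n)%N then fps_coef g (m - p) (n - q) else 0.
Proof.
rewrite fps_coefM /=.
case: ifP => [/andP[pm qn]|pq].
  rewrite (bigD1 (inord p)) //= [X in _ + X]big1 ?addr0; last first.
    move=> i ip; rewrite big1 // => j _.
    suff /negPf-> : (i : nat) != p by rewrite mul0r.
    by apply: contraNneq ip => <-; rewrite inord_val.
  rewrite (bigD1 (inord q)) //= big1 ?addr0; last first.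
    move=> j jq; suff /negPf-> : (j : nat) != q by rewrite andbF mul0r.
    by apply: contraNneq jq => <-; rewrite inord_val.
  by rewrite !inordK ?ltnS // !eqxx mul1r.
rewrite big1 // => i _; rewrite big1 // => j _.
case: eqP => [ip|]; case: eqP => [jq|]; rewrite ?mul0r //.
by move: pq; rewrite -ip -jq !leq_ord.
Qed.

Lemma fps_mon_mul p q p' q' :
  fps_mon p q * fps_mon p' q' = fps_mon (p + p') (q + q').
Proof.
apply: fps2P => m n; rewrite fps_coef_monM /=.
case: ifP => pq; first by congr (_%:R); lia.
have -> : (m == (p + p')%N) && (n == (q + q')%N) = false by lia.
by [].
Qed.

Lemma fps_monE p q : fps_a K ^+ p * fps_b K ^+ q = fps_mon p q.
Proof.
have mon0 : 1 = fps_mon 0 0 by apply: fps2P.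
have -> : fps_a K ^+ p = fps_mon p 0.
  by elim: p => [|p IHp]; rewrite ?expr0 // exprS IHp (fps_mon_mul 1 0).
have -> : fps_b K ^+ q = fps_mon 0 q.
  by elim: q => [|q IHq]; rewrite ?expr0 // exprS IHq (fps_mon_mul 0 1).
by rewrite fps_mon_mul addn0.
Qed.

Lemma fps_unit1B_mon p q : (0 < p + q)%N -> 1 - fps_mon p q \is a GRing.unit.
Proof. by move=> pq; apply: fps_unit1B => /=; case: p q pq => [|p] [|q]. Qed.

Lemma eq_fps_coefMr f g g' m n :
  (forall i j, (i <= m)%N -> (j <= n)%N -> fps_coef g i j = fps_coef g' i j) ->
  fps_coef (f * g) m n = fps_coef (f * g') m n.
Proof.
move=> gg'; rewrite !fps_coefM; apply: eq_bigr => i _; apply: eq_bigr => j _.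
by rewrite gg' ?leq_subr.
Qed.

End Monomial.

(** * Alternating weight of a partition *)

(** Dropping the head shifts every index by one, so the sums over odd and even positions trade
    places. The pair holds the exponents of [a] and [b] in [omega]. *)
Fixpoint alt_wt (l : seq nat) : nat * nat :=
  if l is x :: l' then ((x + (alt_wt l').2)%N, (alt_wt l').1) else (0%N, 0%N).

(** The bound [M] is free because the two components of the induction step call the hypothesis at
    [M] and at [M.+1]. *)
Lemma alt_wt_sumE l M : (size l <= M)%N ->
  alt_wt l = (\sum_(0 <= i < M) nth 0%N l (2 * i),
              \sum_(0 <= i < M) nth 0%N l (2 * i).+1)%N.
Proof.
elim: l M => [|x l IHl] [|M] //=.
- by move=> _; rewrite !big1 // => i _; rewrite nth_nil.
- by move=> _; rewrite !big1 // => i _; rewrite nth_nil.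
rewrite ltnS => lM; congr pair; last first.
  by rewrite (IHl M.+1) // ltnW.
rewrite big_nat_recl // muln0 /= (IHl M) //=; congr addn.
by apply: eq_bigr => i _; congr nth; lia.
Qed.

Lemma omegaE (K : comNzRingType) l :
  omega (fps_a K) (fps_a K) (fps_b K) (fps_b K) l =
  fps_mon (alt_wt l).1 (alt_wt l).2.
Proof.
have half_sum (f : nat -> nat) :
    ((\sum_(1 <= i < (size l).+1) uphalf (f i)) +
     \sum_(1 <= i < (size l).+1) (f i)./2 =
     \sum_(0 <= i < size l) f i.+1)%N.
  rewrite -big_split big_add1 /=; apply: eq_bigr => i _.
  by rewrite uphalf_half -addnA addnn odd_double_half.
rewrite /omega -exprD -mulrA -exprD !half_sum fps_monE (alt_wt_sumE (leqnn _)).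
by congr fps_mon; apply: eq_bigr => i _; congr nth; lia.
Qed.

Lemma alt_wt_cat_even s t k c :
  alt_wt (s ++ nseq c.*2 k ++ t) =
  ((alt_wt (s ++ t)).1 + k * c, (alt_wt (s ++ t)).2 + k * c)%N.
Proof.
elim: s => [|x s /= ->] /=; last by rewrite addnA.
by elim: c => [|c /= ->] /=; [rewrite muln0 !addn0; case: alt_wt | congr pair; lia].
Qed.

Lemma alt_wt_sumn l : ((alt_wt l).1 + (alt_wt l).2 = sumn l)%N.
Proof. by elim: l => //= x l <-; lia. Qed.

Lemma size_leq_sumn l : all (leq 1) l -> (size l <= sumn l)%N.
Proof. by elim: l => //= x l IHl /andP[x0 /IHl]; lia. Qed.

Lemma mem_leq_sumn x l : x \in l -> (x <= sumn l)%N.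
Proof. by elim: l => //= y l IHl; rewrite inE => /orP[/eqP|/IHl]; lia. Qed.

Fixpoint bounded_seqs (N k : nat) : seq (seq nat) :=
  if k is k'.+1 then
    [::] :: [seq x :: l | x <- iota 0 N.+1, l <- bounded_seqs N k']
  else [:: [::]].

Lemma mem_bounded_seqs N k l :
  (size l <= k)%N -> all (leq^~ N) l -> l \in bounded_seqs N k.
Proof.
elim: k l => [|k IHk] [|x l] // lk /andP[xN lN].
have -> : bounded_seqs N k.+1 =
    [::] :: [seq x :: l | x <- iota 0 N.+1, l <- bounded_seqs N k] by [].
rewrite inE; apply/orP; right.
by apply/allpairsP; exists (x, l); rewrite mem_iota IHk.
Qed.

(** * Counting series of a set of partitions *)

Section CountingSeries.
Context {K : comNzRingType}.
Implicit Types A B : set (seq nat).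

(** A partition of weight [(m, n)] has size [m + n], hence at most [m + n] parts, each at most
    [m + n]: a finite search suffices. *)
Definition alt_fibre A (m n : nat) : seq (seq nat) :=
  [seq l <- undup (bounded_seqs (m + n) (m + n)) |
    `[< A l >] && (alt_wt l == (m, n))].

Definition alt_gf A : fps2 K := Fps2 (fun m n => (size (alt_fibre A m n))%:R).

Definition partitions : set (seq nat) := [set l | is_partition l].

Lemma mem_alt_fibre A m n l : A `<=` partitions ->
  (l \in alt_fibre A m n) = `[< A l >] && (alt_wt l == (m, n)).
Proof.
move=> Apar; rewrite mem_filter; apply: andb_idr => /andP[/asboolP Al /eqP wl].
have /andP[_ l_pos] := Apar _ Al; have := alt_wt_sumn l; rewrite wl /= => mn.
rewrite mem_undup mem_bounded_seqs // ?mn ?size_leq_sumn //.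
by apply/allP => x /mem_leq_sumn.
Qed.

Lemma alt_fibre_uniq A m n : uniq (alt_fibre A m n).
Proof. by rewrite filter_uniq // undup_uniq. Qed.

(** Lets a coefficient be read off any duplicate-free enumeration of the fibre, independently of
    [bounded_seqs]. *)
Lemma alt_gf_coef A m n s : A `<=` partitions -> uniq s ->
  (forall l, (l \in s) = `[< A l >] && (alt_wt l == (m, n))) ->
  fps_coef (alt_gf A) m n = (size s)%:R.
Proof.
move=> Apar us sE; rewrite /=; congr (_%:R); apply: perm_size.
by apply: uniq_perm => // [|l]; rewrite ?alt_fibre_uniq // sE mem_alt_fibre.
Qed.

Lemma eq_alt_gf_coef A B m n : A `<=` partitions -> B `<=` partitions ->
  (forall l, is_partition l -> alt_wt l = (m, n) -> A l <-> B l) ->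
  fps_coef (alt_gf A) m n = fps_coef (alt_gf B) m n.
Proof.
move=> Apar Bpar AB; apply: alt_gf_coef => // [|l]; first exact: alt_fibre_uniq.
rewrite mem_alt_fibre //; case: eqP => wl; rewrite ?andbF // !andbT.
apply/asboolP/asboolP => [Bl|Al].
  exact/(AB _ (Bpar _ Bl) wl).
exact/(AB _ (Apar _ Al) wl).
Qed.

Lemma alt_gf_split A B : A `<=` partitions ->
  alt_gf A = alt_gf (A `&` B) + alt_gf (A `\` B).
Proof.
move=> Apar; apply: fps2P => m n; rewrite fps_coefD.
have cond C : A `&` C `<=` partitions by move=> l [/Apar].
have countE C : fps_coef (alt_gf (A `&` C)) m n =
    (count (fun l => `[< C l >]) (alt_fibre A m n))%:R.
  rewrite -size_filter; apply: alt_gf_coef => //.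
    by rewrite filter_uniq ?alt_fibre_uniq.
  by move=> l; rewrite mem_filter mem_alt_fibre // asbool_and andbA (andbC `[< C l >]).
rewrite setDE !countE -natrD /=; congr (_%:R).
rewrite -(count_predC (fun l => `[< B l >])); congr addn.
by apply: eq_count => l; rewrite /= -asbool_neg.
Qed.

(** The map [f] matches the fibre of [A] at [(m - p, n - q)] with that of the image at [(m, n)]; the
    latter is empty when [m < p] or [n < q]. *)
Lemma alt_gf_image A (f : seq nat -> seq nat) p q :
  A `<=` partitions -> f @` A `<=` partitions ->
  {in A &, injective f} ->
  (forall l, A l -> alt_wt (f l) = ((alt_wt l).1 + p, (alt_wt l).2 + q)%N) ->
  alt_gf (f @` A) = fps_mon p q * alt_gf A.
Proof.
move=> Apar fApar f_inj f_wt; apply: fps2P => m n; rewrite fps_coef_monM.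
case: ifP => [/andP[pm qn]|pq]; last first.
  apply: (@alt_gf_coef _ _ _ [::]) => // l; symmetry; apply/negP.
  by move=> /andP[/asboolP[l' Al' <-]]; rewrite f_wt // => /eqP[]; lia.
rewrite [RHS]/= -(size_map f); apply: alt_gf_coef => // [|l].
  rewrite map_inj_in_uniq ?alt_fibre_uniq // => l l'.
  rewrite !mem_alt_fibre // => /andP[/asboolP Al _] /andP[/asboolP Al' _].
  by apply: f_inj; rewrite inE.
apply/mapP/andP => [[l'] | [/asboolP[l' Al' <-]]].
  rewrite mem_alt_fibre // => /andP[/asboolP Al' /eqP wl'] ->.
  by split; [apply/asboolP; exists l' | rewrite f_wt // wl' /= !subnK].
rewrite f_wt // => /eqP wl'; exists l' => //.
rewrite mem_alt_fibre //; apply/andP; split; first exact/asboolP.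
by case: (alt_wt l') wl' => u v [<- <-]; rewrite !addnK.
Qed.

Lemma alt_gf_has_sum A : A `<=` partitions ->
  fps_has_sum A (fun l => fps_mon (alt_wt l).1 (alt_wt l).2) (alt_gf A).
Proof.
(* Once a finite set contains the whole fibre, its other terms have other weights and leave this
   coefficient alone. *)
move=> Apar m n; exists [fset l in alt_fibre A m n]%fset.
  by move=> l /=; rewrite inE mem_alt_fibre // => /andP[/asboolP].
move=> S SA fS.
have -> : fps_coef (\sum_(l <- S) fps_mon (alt_wt l).1 (alt_wt l).2) m n =
    \sum_(l <- S) (alt_wt l == (m, n))%:R :> K.
  elim: (S : seq _) => [|l s IHs]; first by rewrite !big_nil.
  rewrite !big_cons fps_coefD IHs /=; congr (_ + _).
  by case: (alt_wt l) => u v; rewrite xpair_eqE [u == m]eq_sym [v == n]eq_sym.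
have -> : \sum_(l <- S) (alt_wt l == (m, n))%:R =
    (count (fun l => alt_wt l == (m, n)) S)%:R :> K.
  by rewrite -natr_sum -sum1_count [in RHS]big_mkcond.
rewrite -size_filter; symmetry.
apply: alt_gf_coef => // [|l]; first by rewrite filter_uniq ?fset_uniq.
rewrite mem_filter andbC; case: eqP => wl; rewrite ?andbF // !andbT.
apply/idP/asboolP => [lS|Al]; first exact: SA.
by apply: (fsubsetP fS); rewrite inE mem_alt_fibre // wl eqxx andbT; apply/asboolP.
Qed.

End CountingSeries.

(** * Adding columns *)

(** Positivity of the parts rules out trailing zeros, which [nth] with default 0 cannot detect. *)
Lemma partition_nth_inj l l' : is_partition l -> is_partition l' ->
  nth 0%N l =1 nth 0%N l' -> l = l'.
Proof.
move=> /andP[_ +] /andP[_ +].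
elim: l l' => [|x l IHl] [|x' l'] //=.
- by move=> _ /andP[+ _] /(_ 0%N) /= => /[swap] <-.
- by move=> /andP[+ _] _ /(_ 0%N) /= => /[swap] ->.
move=> /andP[_ lp] /andP[_ lp'] ll'; rewrite (IHl l') //.
  by have /= -> := ll' 0%N.
by move=> i; have := ll' i.+1.
Qed.

Lemma partition_nth_noninc l i : is_partition l ->
  (nth 0%N l i.+1 <= nth 0%N l i)%N.
Proof.
move=> /andP[/(sortedP 0%N) ls _]; case: (ltnP i.+1 (size l)) => il.
  exact: ls.
by rewrite nth_default.
Qed.

Lemma ex_partition_nth (f : nat -> nat) N :
  (forall i, f i.+1 <= f i)%N -> f N = 0%N ->
  exists2 l, is_partition l & nth 0%N l =1 f.
Proof.
move=> f_noninc; case: (posnP (f 0%N)) => [f0 _|].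
  exists [::] => // i; rewrite nth_nil; apply/eqP; rewrite eq_sym -leqn0 -f0.
  by elim: i => // i; apply: leq_trans.
elim: N f f_noninc => [|N IHN] f f_noninc f0 fN; first by rewrite fN in f0.
case: (posnP (f 1%N)) => [f1|f1].
  exists [:: f 0%N]; first by rewrite /is_partition /= f0.
  case=> // i; rewrite /= nth_nil; apply/eqP; rewrite eq_sym -leqn0 -f1.
  by elim: i => // i; apply: leq_trans.
have [|l lpar lf] := IHN (fun i => f i.+1) _ f1 fN; first by [].
exists (f 0%N :: l); last by case.
move: lpar; rewrite /is_partition /= f0 => /andP[ls ->]; rewrite andbT.
by case: l ls lf => //= x l -> /(_ 0%N) /= ->; rewrite /geq /= f_noninc.
Qed.

(** The default in [head] allows a column taller than [l], which creates new parts equal to 1. *)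
Fixpoint add_column (h : nat) (l : seq nat) : seq nat :=
  if h is h'.+1 then (head 0%N l).+1 :: add_column h' (behead l) else l.

Lemma nth_add_column h l i :
  nth 0%N (add_column h l) i = (nth 0%N l i + (i < h))%N.
Proof.
elim: h l i => [|h IHh] l [|i] /=; rewrite ?addn0 //.
  by rewrite nth0 addn1.
by rewrite IHh nth_behead.
Qed.

Lemma alt_wt_add_column h l :
  alt_wt (add_column h l) =
  ((alt_wt l).1 + uphalf h, (alt_wt l).2 + h./2)%N.
Proof.
elim: h l => [|h IHh] l /=; first by rewrite !addn0; case: alt_wt.
rewrite IHh; case: l => [|x l] //=; congr pair; lia.
Qed.

Lemma add_column_partition h l :
  is_partition l -> is_partition (add_column h l).
Proof.
move=> lp; apply/andP; split.
  apply/(sortedP 0%N) => i _; rewrite /geq /= !nth_add_column.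
  by have := partition_nth_noninc i lp; lia.
have /andP[_] := lp; elim: h l {lp} => //= h IHh [|x l] /=.
  by move=> _; apply: IHh.
by case/andP => _; apply: IHh.
Qed.

(* The condition says that all columns of [l] have their height in [P]. *)
Definition heights_in (P : pred nat) : set (seq nat) :=
  [set l | is_partition l /\
    forall i, (nth 0%N l i.+1 < nth 0%N l i)%N -> P i.+1].

Lemma heights_in_partitions P : heights_in P `<=` partitions.
Proof. by move=> l []. Qed.

(** A column of height [h.+1] exists exactly when there is a strict drop from index [h] to [h.+1];
    one such column can then be removed, and adding it back always creates that drop. *)
Lemma heights_in_last (P : pred nat) h : P h.+1 ->
  heights_in P `\` heights_in [pred i | P i & i != h.+1] =
  add_column h.+1 @` heights_in P.
Proof.
move=> Ph; apply/seteqP; split => [l [[lp lP] nlP]|_ [l [lp lP] <-]].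
  have lh : (nth 0%N l h.+1 < nth 0%N l h)%N.
    rewrite ltnNge; apply/negP => lh; apply: nlP; split => // i li /=.
    by rewrite lP //=; apply: contraTneq li => -[->]; rewrite -leqNgt.
  (* The first [h.+1] parts are positive, so subtracting 1 from each is not truncated. *)
  have l_h i : (i <= h)%N -> (0 < nth 0%N l i)%N.
    move=> ih; apply: leq_trans (leq_trans _ lh) _ => //.
    elim: h ih {lh Ph nlP} => [|h IHh]; first by rewrite leqn0 => /eqP->.
    rewrite leq_eqVlt => /predU1P[->//|/IHh]; apply: leq_trans.
    exact: partition_nth_noninc.
  (* The preimage is [l] with one column of height [h.+1] removed; the drop [lh] keeps the values
     nonincreasing. *)
  have [i||l' l'p l'E] :=
    @ex_partition_nth (fun i => nth 0%N l i - (i < h.+1))%N (size l).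
  - have := partition_nth_noninc i lp.
    by case: (ltngtP i h) => [||->]; lia.
  - by rewrite nth_default.
  exists l'; last first.
    apply: partition_nth_inj => //; first exact: add_column_partition.
    by move=> i; rewrite nth_add_column l'E subnK // ; case: ltnP => // /l_h.
  split => // i; rewrite !l'E => li.
  have [-> //|ih] := eqVneq i h; apply: lP; move: li.
  by have := l_h i; have := l_h i.+1; lia.
split; first split; first exact: add_column_partition.
  move=> i; rewrite !nth_add_column.
  by have [-> //|ih] := eqVneq i h => li; apply: lP; lia.
case=> _ /(_ h); rewrite !nth_add_column /= eqxx andbF ltnn.
by have := partition_nth_noninc h lp; lia.
Qed.

Lemma add_column_inj h : {in partitions &, injective (add_column h)}.
Proof.
move=> l l'; rewrite !inE => lp lp' ll'; apply: partition_nth_inj => // i.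
by apply/eqP; rewrite -(eqn_add2r (i < h)) -!nth_add_column ll'.
Qed.

(** * Product formula for prescribed column heights *)

Section Products.
Context {K : comNzRingType}.

(** Multiplying by the monomial counts the partitions having at least one column of height [h.+1];
    subtracting them leaves those with none. *)
Lemma alt_gf_heights_in (P : pred nat) h : P h.+1 ->
  (1 - fps_mon (uphalf h.+1) h.+1./2) * alt_gf (heights_in P) =
  alt_gf (heights_in [pred i | P i & i != h.+1]) :> fps2 K.
Proof.
move=> Ph; have Ppar := @heights_in_partitions P.
rewrite mulrBl mul1r -(@alt_gf_image _ _ (add_column h.+1)) //; last 3 first.
- by move=> _ [l /Ppar lp <-]; apply: add_column_partition.
- move=> l l'; rewrite !inE => /Ppar lp /Ppar lp'.
  by apply: add_column_inj; rewrite inE.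
- by move=> l _; rewrite alt_wt_add_column.
rewrite (alt_gf_split (heights_in [pred i | P i & i != h.+1]) Ppar).
rewrite heights_in_last // addrK; congr alt_gf; apply/setIidPr => l [lp lP].
by split=> // i /lP /andP[].
Qed.

Definition col_factor (j : nat) : fps2 K :=
  (1 + fps_mon j j.-1) / ((1 - fps_mon j j) * (1 - fps_mon (2 * j) (2 * j - 2))).

(** With [x = a^j b^(j-1)], the second denominator is [1 - x^2 = (1 - x)(1 + x)], so the numerator
    cancels. *)
Lemma col_factorK j : (0 < j)%N ->
  col_factor j * ((1 - fps_mon j j) * (1 - fps_mon j j.-1)) = 1.
Proof.
case: j => // j _; rewrite /col_factor /=.
have -> : fps_mon (2 * j.+1) (2 * j.+1 - 2) = fps_mon j.+1 j ^+ 2 :> fps2 K.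
  by rewrite expr2 fps_mon_mul; congr fps_mon; lia.
have u2 : 1 - fps_mon j.+1 j ^+ 2 \is a @GRing.unit (fps2 K).
  by rewrite expr2 fps_mon_mul fps_unit1B_mon.
have u1 : 1 - fps_mon j.+1 j.+1 \is a @GRing.unit (fps2 K).
  exact: fps_unit1B_mon.
rewrite mulrAC mulrCA [(1 + fps_mon _ _) * _]mulrC -subr_sqr expr1n divrr //.
by rewrite unitrM u1.
Qed.

(** The heights with [uphalf h = j] are [2j - 1] and [2j], so each new [j] allows exactly two more
    heights. *)
Lemma prod_col_factor (s : seq nat) : uniq s -> 0%N \notin s ->
  \prod_(j <- s) col_factor j =
  alt_gf (heights_in [pred h | uphalf h \in s]).
Proof.
elim: s => [_ _|j s IHs /= /andP[js us]].
  rewrite big_nil; apply: fps2P => m n.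
  rewrite (@alt_gf_coef _ _ _ _ (if (m, n) == (0, 0)%N then [:: [::]] else [::])).
  - by rewrite fps_coef1 xpair_eqE; case: ifP.
  - exact: heights_in_partitions.
  - by case: ifP.
  (* With no height allowed there is no drop, so every entry equals one beyond the end of [l], that
     is 0. *)
  have -> : heights_in [pred h | uphalf h \in [::]] = [set [::]].
    apply/seteqP; split=> [l [lp lP]|_ ->]; last by split=> // i; rewrite !nth_nil.
    apply: partition_nth_inj => // i; rewrite nth_nil; apply/eqP.
    have li k : (nth 0%N l i <= nth 0%N l (k + i))%N.
      elim: k => // k /leq_trans; apply; rewrite addSn leqNgt.
      by apply/negP => /lP.
    by rewrite -leqn0 (leq_trans (li (size l))) // nth_default ?leq_addr.
  move=> l; case: l => [|x l].
    rewrite [alt_wt _]/= [RHS]andb_idl; last by move=> _; apply/asboolP.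
    by rewrite [RHS]eq_sym; case: ifP.
  have -> : `[< [set [::]] (x :: l) >] = false by apply/asboolP.
  by case: ifP.
rewrite inE negb_or => /andP[j0 s0]; rewrite big_cons IHs //.
have {j0} j0 : (0 < j)%N by rewrite lt0n eq_sym.
set P := [pred h | uphalf h \in j :: s].
(* From [P], the odd height [2j - 1] is removed first, then the even height [2j]. *)
have -> : alt_gf (heights_in [pred h | uphalf h \in s]) =
    (1 - fps_mon j j) * (1 - fps_mon j j.-1) * alt_gf (heights_in P) :> fps2 K.
  case: j => // j in js j0 P *; rewrite -mulrA.
  have := @alt_gf_heights_in P j.*2; rewrite /= uphalf_double doubleK => -> //; last first.
    exact: mem_head.
  have := @alt_gf_heights_in [pred i | P i & i != j.*2.+1] j.*2.+1.
  rewrite /= doubleK uphalf_double => ->.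
    congr alt_gf; congr heights_in; apply/funext => h /=; rewrite !inE.
    have [hj|hj] /= := eqVneq (uphalf h) j.+1.
      by rewrite hj (negPf js); lia.
    by case: (_ \in s) => //=; lia.
  by rewrite mem_head /=; lia.
by rewrite mulrA col_factorK ?mul1r.
Qed.

End Products.

(** * Inserting equal parts *)

Definition insert_parts (k r : nat) (l : seq nat) : seq nat :=
  [seq x <- l | (r <= x)%N] ++ nseq k r ++ [seq x <- l | (x < r)%N].

Lemma geq_trans : transitive geq.
Proof. by move=> y x z /= xy yz; apply: leq_trans yz xy. Qed.

Lemma geq_anti : antisymmetric geq.
Proof. by move=> x y /= /andP[yx xy]; apply/eqP; rewrite eqn_leq xy yx. Qed.

Lemma geq_total : total geq.
Proof. by move=> x y; apply: leq_total. Qed.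

Lemma filter_geq_ltn_cat l r : sorted geq l ->
  [seq x <- l | (r <= x)%N] ++ [seq x <- l | (x < r)%N] = l.
Proof.
elim: l => //= x l IHl xl; have ls := path_sorted xl.
case: leqP => xr /=; first by rewrite IHl.
have lr : all (gtn r) l.
  have /allP xl' := order_path_min geq_trans xl.
  by apply/allP => y /xl' /= yx; apply: leq_ltn_trans yx xr.
have /eq_in_filter -> : {in l, leq r =1 xpred0}.
  by move=> y /(allP lr) /=; rewrite ltnNge => /negPf.
by rewrite filter_pred0 /=; congr cons; apply/all_filterP.
Qed.

Lemma perm_insert_parts k r l : perm_eq (insert_parts k r l) (nseq k r ++ l).
Proof.
rewrite /insert_parts perm_catCA perm_cat2l.
have -> : [seq x <- l | (x < r)%N] = [seq x <- l | predC (leq r) x].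
  by apply: eq_filter => x /=; rewrite ltnNge.
by rewrite perm_filterC.
Qed.

Lemma insert_parts_sorted k r l : sorted geq l ->
  sorted geq (insert_parts k r l).
Proof.
move=> ls; rewrite (sorted_pairwise geq_trans) /insert_parts !pairwise_cat.
rewrite -!(sorted_pairwise geq_trans) !sorted_filter ?andbT //; last 2 first.
- exact: geq_trans.
- exact: geq_trans.
rewrite allrel_catr; apply/and3P; split.
- apply/andP; split; apply/allrelP => x y; rewrite mem_filter => /andP[rx _].
    by rewrite mem_nseq => /andP[_ /eqP->].
  by rewrite mem_filter => /andP[yr _]; apply: leq_trans (ltnW yr) rx.
- by [].
apply/andP; split.
  apply/allrelP => x y; rewrite mem_nseq mem_filter => /andP[_ /eqP->] /andP[yr _].
  exact: ltnW.
by rewrite (sorted_pairwise geq_trans); elim: k => //= k ->;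
  rewrite andbT; apply/allP => x; rewrite mem_nseq => /andP[_ /eqP->] /=.
Qed.

Lemma alt_wt_insert_parts k r l : sorted geq l -> ~~ odd k ->
  alt_wt (insert_parts k r l) =
  ((alt_wt l).1 + r * k./2, (alt_wt l).2 + r * k./2)%N.
Proof.
move=> ls ke; rewrite /insert_parts -{1}(even_halfK ke) alt_wt_cat_even.
by rewrite filter_geq_ltn_cat.
Qed.

Lemma insert_parts_partition k r l : (0 < r)%N -> is_partition l ->
  is_partition (insert_parts k r l).
Proof.
move=> r0 /andP[ls lp]; rewrite /is_partition insert_parts_sorted //=.
by rewrite (perm_all _ (perm_insert_parts k r l)) all_cat lp all_nseq r0 orbT.
Qed.

Lemma insert_parts_inj k r : {in partitions &, injective (insert_parts k r)}.
Proof.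
move=> l l'; rewrite !inE => /andP[ls _] /andP[ls' _] ll'.
apply: (sorted_eq geq_trans geq_anti) => //.
rewrite -(perm_cat2l (nseq k r)) -(permPl (perm_insert_parts k r l)) ll'.
exact: perm_insert_parts.
Qed.

Lemma Par_partitions R rho : Par R rho `<=` partitions.
Proof. by move=> l []. Qed.

(** Violating the bound at [r] means having at least [rho r] copies of [r]. Removing or inserting
    that many affects no bound indexed by [R], since [r] is not in [R]. *)
Lemma ParU1_last (R : set nat) rho r : (0 < r)%N -> ~ R r ->
  Par R rho `\` Par (r |` R) rho = insert_parts (rho r) r @` Par R rho.
Proof.
move=> r0 nRr; apply/seteqP; split=> [l [[lp lR] nl]|_ [l [lp lR] <-]].
  have lr : (rho r <= count_mem r l)%N.
    rewrite leqNgt; apply/negP => lr; apply: nl; split => // x [->//|].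
    exact: lR.
  have /andP[ls l_pos] := lp.
  (* The parts of [l] with [rho r] copies of [r] deleted, in an order that sorting repairs. *)
  pose l1 := nseq (count_mem r l - rho r) r ++ [seq x <- l | x != r].
  have l1_perm : perm_eq l (nseq (rho r) r ++ l1).
    rewrite /l1 catA -nseqD subnKC // perm_sym.
    rewrite -size_filter -(all_pred1P _ _ (filter_all (pred1 r) l)).
    by rewrite perm_filterC.
  pose l' := sort geq l1.
  have l'l : l = insert_parts (rho r) r l'.
    apply: (sorted_eq geq_trans geq_anti) => //.
      by rewrite insert_parts_sorted // sort_sorted //; apply: geq_total.
    rewrite (permPr (perm_insert_parts _ _ _)) (permPl l1_perm) perm_cat2l.
    by rewrite perm_sym perm_sort.
  exists l' => //; split.
    rewrite /is_partition sort_sorted /=; last exact: geq_total.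
    rewrite all_sort; move: l_pos; rewrite (perm_all _ l1_perm) all_cat.
    by case/andP.
  move=> x /[dup] Rx /lR; apply: leq_ltn_trans.
  by rewrite [in X in (_ <= X)%N]l'l (permP (perm_insert_parts _ _ _)) count_cat leq_addl.
split; first split; first exact: insert_parts_partition.
  move=> x Rx; rewrite (permP (perm_insert_parts _ _ _)) count_cat count_nseq /=.
  have /negPf-> : r != x by apply: contra_notN nRr => /eqP->.
  by rewrite mul0n lR.
case=> _ /(_ r (or_introl erefl)).
rewrite (permP (perm_insert_parts _ _ _)) count_cat count_nseq /= eqxx mul1n.
by rewrite ltnNge leq_addr.
Qed.

(** * Multiplicity restrictions and passage to the limit *)

Section Limits.
Context {K : comNzRingType}.

Lemma alt_gf_ParU1 (R : set nat) rho r : (0 < r)%N -> ~~ odd (rho r) -> ~ R r ->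
  alt_gf (Par (r |` R) rho) =
  (1 - fps_mon (r * (rho r)./2) (r * (rho r)./2)) * alt_gf (Par R rho) :> fps2 K.
Proof.
move=> r0 re nRr; have Rpar := @Par_partitions R rho.
rewrite mulrBl mul1r -(@alt_gf_image _ _ (insert_parts (rho r) r)) //; last 3 first.
- by move=> _ [l /Rpar lp <-]; apply: insert_parts_partition.
- move=> l l'; rewrite !inE => /Rpar lp /Rpar lp'.
  by apply: insert_parts_inj; rewrite inE.
- by move=> l [/andP[ls _] _]; rewrite alt_wt_insert_parts.
rewrite [in RHS](alt_gf_split (Par (r |` R) rho) Rpar) ParU1_last // addrK.
congr alt_gf; symmetry; apply/setIidPr => l [lp lR].
by split=> // x Rx; apply: lR; right.
Qed.

Lemma prod_alt_gf_Par (s : seq nat) rho : uniq s ->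
  {in s, forall r, (0 < r)%N /\ ~~ odd (rho r)} ->
  (\prod_(r <- s) (1 - fps_mon (r * (rho r)./2) (r * (rho r)./2))) *
    alt_gf partitions = alt_gf (Par [set` s] rho) :> fps2 K.
Proof.
elim: s => [_ _|r s IHs /= /andP[rs us] rP].
  by rewrite big_nil mul1r; congr alt_gf; apply/seteqP; split=> [l|l []].
rewrite big_cons -mulrA IHs // => [|x xs]; last by apply: rP; rewrite inE xs orbT.
have [r0 re] := rP r (mem_head _ _).
rewrite -alt_gf_ParU1 //; last exact/negP.
congr alt_gf; congr Par; apply/seteqP; split => x /=; rewrite inE.
  by case=> [->|->]; rewrite ?eqxx ?orbT.
by case/predU1P; [left|right].
Qed.

(** The empty partition is the only one of size 0, so the constant coefficient is 1. Invertibility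
    lets the product over [R] be written as a quotient. *)
Lemma alt_gf_partitions_unit : alt_gf partitions \is a @GRing.unit (fps2 K).
Proof.
rewrite -[alt_gf _](subKr 1); apply: fps_unit1B.
rewrite fps_coefD fps_coefN (@alt_gf_coef _ _ _ _ [:: [::]]) ?subrr //.
case=> [|x l]; first by symmetry; apply/andP; split=> //; apply/asboolP.
symmetry; apply/negP => /andP[/asboolP /andP[_ /= /andP[x0 _]]].
by rewrite xpair_eqE; lia.
Qed.

Lemma col_factor_has_prod :
  fps_has_prod [set j | (0 < j)%N] col_factor (alt_gf partitions : fps2 K).
Proof.
(* Columns of a partition of size [m + n] have height at most [m + n], so factors up to that index
   already allow them all. *)
move=> m n; exists [fset j in iota 1 (m + n)]%fset.
  by move=> j /=; rewrite inE mem_iota => /andP[].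
move=> S S_pos mnS; rewrite prod_col_factor ?fset_uniq //; last first.
  by apply/negP => /S_pos.
apply: eq_alt_gf_coef => // [|l lp wl]; first exact: heights_in_partitions.
split=> [[]//|_]; split=> // i li; apply: (fsubsetP mnS).
have /andP[_ l_pos] := lp.
have := size_leq_sumn l_pos; rewrite -alt_wt_sumn wl /= inE mem_iota.
have : (i < size l)%N by rewrite ltnNge; apply: contraTN li => /(nth_default 0%N) ->.
lia.
Qed.

Lemma part_factor_has_prod (R : set nat) rho :
  (forall r, R r -> (0 < r)%N) ->
  (forall r, R r -> (0 < rho r)%N /\ ~~ odd (rho r)) ->
  fps_has_prod R (fun r => 1 - fps_mon (r * (rho r)./2) (r * (rho r)./2))
    ((alt_gf partitions)^-1 * alt_gf (Par R rho) : fps2 K).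
Proof.
move=> R_pos rho_even m n.
(* Only restrictions on parts [r <= m + n] can be felt by partitions of size at most [m + n]. *)
exists [fset r in iota 0 (m + n).+1 | `[< R r >]]%fset.
  by move=> r /=; rewrite !inE => /andP[_ /asboolP].
move=> S SR mnS.
have /(canRL (mulrK alt_gf_partitions_unit)) -> :=
    @prod_alt_gf_Par S rho (fset_uniq S) (fun r rS =>
      conj (R_pos _ (SR _ rS)) (rho_even _ (SR _ rS)).2).
(* The inverse series is a common factor, so comparing the counting series at indices up to [(m, n)]
   is enough. *)
rewrite mulrC; apply: eq_fps_coefMr => i j im jn.
apply: eq_alt_gf_coef; [exact: Par_partitions | exact: Par_partitions |].
move=> l lp wl; split=> -[_ lR]; split=> // r; last by move/SR/lR.
move=> Rr; have [rS|rS] := boolP (r \in S); first exact: lR.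
(* An [r] outside [S] is too large to be a part; its multiplicity 0 meets the bound because [rho r]
   is positive. *)
suff /count_memPn-> : r \notin l by have [] := rho_even _ Rr.
apply: contra rS => /mem_leq_sumn; rewrite -alt_wt_sumn wl /= => rij.
apply: (fsubsetP mnS); rewrite !inE mem_iota; apply/andP; split; last exact/asboolP.
lia.
Qed.

End Limits.

Theorem theorem2p3 (K : comNzRingType) (R : set nat) (rho : nat -> nat)
    (R_pos : forall r : nat, R r -> (0 < r)%N)
    (rho_even : forall r : nat, R r -> (0 < rho r)%N /\ ~~ odd (rho r)) :
  let a : fps2 K := fps_a K in
  let b : fps2 K := fps_b K in
  let F (j : nat) : fps2 K :=
    (1 + a ^+ (uphalf j + j./2) * b ^+ (uphalf (j - 1) + (j - 1)./2))
      / ((1 - a ^+ (uphalf j + j./2) * b ^+ (uphalf j + j./2))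
         * (1 - a ^+ (2 * j) * b ^+ (2 * j - 2))) in
  let G (r : nat) : fps2 K :=
    1 - a ^+ ((uphalf r + r./2) * (rho r)./2)
        * b ^+ ((uphalf r + r./2) * (rho r)./2) in
  [/\ fps_summable (Par R rho) (omega a a b b),
      fps_multipliable [set j : nat | (0 < j)%N] F,
      fps_multipliable R G &
      Phi R rho a a b b = fps_prod [set j : nat | (0 < j)%N] F * fps_prod R G].
Proof.
move=> a b F G.
have halfE j : (uphalf j + j./2 = j)%N by lia.
have -> : F = col_factor.
  by apply/funext => j; rewrite /F !halfE !fps_monE subn1.
have -> : G = fun r => 1 - fps_mon (r * (rho r)./2) (r * (rho r)./2).
  by apply/funext => r; rewrite /G !halfE fps_monE.
have sumP : fps_has_sum (Par R rho) (omega a a b b) (alt_gf (Par R rho)).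
  have -> : omega a a b b = fun l => fps_mon (alt_wt l).1 (alt_wt l).2.
    by apply/funext => l; rewrite omegaE.
  exact/alt_gf_has_sum/Par_partitions.
have prodF := @col_factor_has_prod K.
have prodG := part_factor_has_prod (K := K) R_pos rho_even.
split; [by eexists; apply: sumP | by eexists; apply: prodF
       | by eexists; apply: prodG |].
rewrite /Phi (fps_sumE sumP) (fps_prodE prodF) (fps_prodE prodG).
(* The first product is the series of all partitions, which cancels the inverse in the second. *)
by rewrite mulVKr // alt_gf_partitions_unit.
Qed.
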